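(* Let $\beta>0$ and let $P$ be the transition matrix of an irreducible and aperiodic $M$-state Markov chain that is a uniform random walk on a $K$-regular graph, i.e. each row of $P$ has exactly $K$ nonzero entries, all equal to $1/K$. Then the type-II error exponent $\eta$ for testing $\mathcal{H}_0$ against $\mathcal{H}_1$ (as defined in the context) satisfies $$\eta\ge\begin{cases}0,&\text{if }\beta\le\sqrt{2\log K},\\ \frac{\beta^2}{2}-\beta\sqrt{2\log K}+\log K,&\text{otherwise.}\end{cases}$$
   Context: Let $\pi$ be the unique stationary distribution of $P=[p_{i,j}]$, and for $s=(s_1,\dots,s_N)\in\{1,\dots,M\}^N$ let $P(s)=\pi_{s_1}p_{s_1,s_2}\cdots p_{s_{N-1},s_N}$. The data are $Y^N=[y_{m,n}]$, $1\le m\le M$, $1\le n\le N$. Under $\mathcal{H}_0$ the $y_{m,n}$ are i.i.d. $\mathcal{N}(0,1)$. Under $\mathcal{H}_1$ a path $s$ is drawn with probability $P(s)$ and, given $s$, the $y_{m,n}$ are independent with law $\mathcal{N}(\beta,1)$ if $m=s_n$ and $\mathcal{N}(0,1)$ if $m\ne s_n$. Fix $\epsilon\in(0,1)$ and let $\delta_N$ be the optimal (Neyman-Pearson, likelihood-ratio threshold) detector based on $Y^N$, i.e. the one minimizing the probability $P_{\mathrm{miss}}$ of deciding $\mathcal{H}_0$ under $\mathcal{H}_1$ subject to the probability of deciding $\mathcal{H}_1$ under $\mathcal{H}_0$ being at most $\epsilon$. The error exponent is $\eta=-\lim_{N\to\infty}\frac1N\log P_{\mathrm{miss}}(\delta_N)$;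 the limit exists, does not depend on $\epsilon$, and equals the Kullback-Leibler divergence rate $-\lim_{N\to\infty}\frac1N\mathbb{E}_0\log\frac{P_1(Y^N)}{P_0(Y^N)}$, where $\mathbb{E}_0$ is expectation under $\mathcal{H}_0$ and $P_0,P_1$ are the densities of $Y^N$ under the two hypotheses. *)

(* Defs.v *)
From HB Require Import structures.
From mathcomp Require Import all_boot all_order all_algebra.
From mathcomp Require Import all_classical all_reals all_analysis.

Set Implicit Arguments.
Unset Strict Implicit.
Unset Printing Implicit Defensive.

Import Order.TTheory GRing.Theory Num.Theory.
Import numFieldNormedType.Exports.

Local Open Scope classical_set_scope.
Local Open Scope ring_scope.

Section tuple_product_measure.
Context {d : measure_display} {T : measurableType d} {R : realType}.

Definition cons_pair (n : nat) (x : T * n.-tuple T) : n.+1.-tuple T :=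
  [tuple of x.1 :: x.2].

Lemma measurable_cons_pair (n : nat) : measurable_fun setT (@cons_pair n).
Proof. exact: measurable_cons measurable_fst measurable_snd. Qed.

HB.instance Definition _ (n : nat) :=
  isMeasurableFun.Build _ _ _ _ (@cons_pair n) (@measurable_cons_pair n).

(* The law of a tuple of independent coordinates, the i-th one having law
   [mu i]. *)
Fixpoint tuple_product (n : nat) :
    ('I_n -> probability T R) -> probability (n.-tuple T) R :=
  match n with
  | 0 => fun _ => \d_([tuple] : 0.-tuple T)
  | n'.+1 => fun mu =>
      distribution (mu ord0 \x tuple_product (fun i => mu (lift ord0 i)))%E
        (@cons_pair n')
  end.

End tuple_product_measure.

Section markov_chain.
Context {R : realType} {M : nat}.
Implicit Types (P : 'M[R]_M) (pi : 'rV[R]_M).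

Definition transition_matrix P : Prop :=
  (forall i j, 0 <= P i j) /\ forall i, \sum_j P i j = 1.

Definition irreducible_chain P : Prop :=
  forall i j, exists n : nat, 0 < (P ^+ n) i j.

(* The gcd of the return times to each state is 1. *)
Definition aperiodic_chain P : Prop :=
  forall i (d : nat),
    (forall n : nat, (0 < n)%N -> 0 < (P ^+ n) i i -> (d %| n)%N) -> d = 1%N.

Definition stationary_distribution P pi : Prop :=
  [/\ forall i, 0 <= pi 0 i, \sum_i pi 0 i = 1 & pi *m P = pi].

Definition uniform_walk_on_regular_graph (K : nat) P : Prop :=
  forall i, #|[set j | P i j != 0]%SET| = K /\
            forall j, P i j != 0 -> P i j = K%:R^-1.

(* [pairmap] lists the transition probabilities along [i :: s']. *)
Definition path_prob P pi (N : nat) (s : N.-tuple 'I_M) : R :=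
  match val s with
  | [::] => 1
  | i :: s' => pi 0 i * \prod_(p <- pairmap (fun j k => P j k) i s') p
  end.

End markov_chain.

(* The n-th coordinate is the column observed at time n, so that y_{m,n} is
   [tnth (tnth y n) m]. *)
Notation data_array R M N := (N.-tuple (M.-tuple (measurableTypeR R))).

Section hypotheses.
Context {R : realType} {M : nat}.
Implicit Types (P : 'M[R]_M) (pi : 'rV[R]_M) (beta eps : R).

Definition gaussian_array (N : nat) (mean : 'I_M -> 'I_N -> R) :
    probability (data_array R M N) R :=
  tuple_product (fun n => tuple_product (fun m => normal_prob (mean m n) 1)).

Definition null_law (N : nat) : probability (data_array R M N) R :=
  gaussian_array (fun _ _ => 0).

Definition path_law beta (N : nat) (s : N.-tuple 'I_M) :
    probability (data_array R M N) R :=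
  gaussian_array (fun m n => if m == tnth s n then beta else 0).

Definition alternative_law beta P pi (N : nat) (A : set (data_array R M N)) :
    \bar R :=
  (\sum_(s : N.-tuple 'I_M) (path_prob P pi s)%:E * path_law beta s A)%E.

(* A detector is identified with the set of data on which it decides for the
   alternative. *)
Definition miss_prob beta P pi (N : nat) (D : set (data_array R M N)) : \bar R :=
  alternative_law beta P pi (~` D).

Definition false_alarm_prob (N : nat) (D : set (data_array R M N)) : \bar R :=
  null_law N D.

Definition optimal_detector beta P pi eps (N : nat)
    (D : set (data_array R M N)) : Prop :=
  [/\ measurable D, (false_alarm_prob D <= eps%:E)%E &
      forall D' : set (data_array R M N), measurable D' ->
        (false_alarm_prob D' <= eps%:E)%E ->
        (miss_prob beta P pi D <= miss_prob beta P pi D')%E].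

(* [fine] only turns a probability into a real number. *)
Definition is_error_exponent beta P pi
    (D : forall N : nat, set (data_array R M N)) (eta : R) : Prop :=
  (fun N : nat => - (N%:R^-1 * ln (fine (miss_prob beta P pi (D N)))))
    @ \oo --> eta.

End hypotheses.

(* Main.v *)
(** The optimal detector misses no more often than any detector of level [eps],
so it suffices to exhibit a good one.  Write [T_s = \sum_n y_{s_n,n}] for the
score of a path [s] and let [sqrt (2 log K) < t < beta].  Decide for the
alternative when the sum over all paths [s] of [K^{-(N-1)} exp (t T_s)] exceeds
[K^{-(N-1)} exp (N t^2)].  There are [M K^{N-1}] paths, so by Markov's
inequality the false alarm probability is at most
[M K^{N-1} exp (- N t^2 / 2)], which tends to [0] because [t^2 / 2 > log K].
A miss forces [T_s <= N t] on the true path, which has probability at most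
[exp (- N (beta - t)^2 / 2)] by the Chernoff bound.  Let [t] decrease to
[sqrt (2 log K)]. *)

Require Import Defs.
From mathcomp Require Import all_boot all_order all_algebra.
From mathcomp Require Import all_classical all_reals all_analysis.
From mathcomp Require Import measurable_realfun ring lra.

Set Implicit Arguments.
Unset Strict Implicit.
Unset Printing Implicit Defensive.

Import Order.TTheory GRing.Theory Num.Theory.
Import numFieldNormedType.Exports.
Local Open Scope classical_set_scope.
Local Open Scope ring_scope.

(** * Integration and absolute continuity for laws of independent tuples *)

Lemma ge0_integral_tuple_productS d (T : measurableType d) (R : realType)
    (n : nat) (mu : 'I_n.+1 -> probability T R) (f : n.+1.-tuple T -> \bar R) :
  measurable_fun setT f -> (forall y, 0 <= f y)%E ->
  (\int[tuple_product mu]_y f y =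
   \int[mu ord0]_x \int[tuple_product (fun i => mu (lift ord0 i))]_y
     f (cons_pair (x, y)))%E.
Proof.
move=> mf f0.
rewrite /= ge0_integral_distribution// fubini_tonelli1//.
by apply: measurableT_comp => //; exact: measurable_cons_pair.
move=> x; exact: f0.
Qed.

(** Independence, by Tonelli one coordinate at a time. The factor [f i] may vary with [i], which
    later allows one entry to be singled out in each column. *)
Lemma ge0_integral_tuple_product_prod d (T : measurableType d) (R : realType)
    (n : nat) (mu : 'I_n -> probability T R) (f : 'I_n -> T -> R)
    (c : 'I_n -> R) :
  (forall i, measurable_fun setT (f i)) -> (forall i x, 0 <= f i x) ->
  (forall i, \int[mu i]_x (f i x)%:E = (c i)%:E)%E ->
  (\int[tuple_product mu]_y (\prod_i f i (tnth y i))%:E = (\prod_i c i)%:E)%E.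
Proof.
elim: n mu f c => [|n IHn] mu f c mf f0 fc.
  under eq_integral do rewrite big_ord0.
  by rewrite big_ord0 integral_cst// mul1e [LHS]probability_setT.
have c0 i : 0 <= c i.
  by rewrite -lee_fin -fc; apply: integral_ge0 => x _; rewrite lee_fin.
rewrite ge0_integral_tuple_productS; last 2 first.
- apply/measurable_EFinP; apply: measurable_prod => i _.
  by apply: measurableT_comp => //; exact: measurable_tnth.
- by move=> y; rewrite lee_fin prodr_ge0.
have inner x : (\int[tuple_product (fun i => mu (lift ord0 i))]_y
    (\prod_i f i (tnth (cons_pair (x, y)) i))%:E =
    (\prod_i c (lift ord0 i))%:E * (f ord0 x)%:E)%E.
  rewrite (eq_integral
    (fun y => (f ord0 x)%:E * (\prod_i f (lift ord0 i) (tnth y i))%:E)%E).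
    rewrite ge0_integralZl ?lee_fin//=.
    - rewrite (IHn _ (fun i => f (lift ord0 i)) (fun i => c (lift ord0 i)))//.
      by rewrite muleC.
    - apply/measurable_EFinP; apply: measurable_prod => i _.
      by apply: measurableT_comp => //; exact: measurable_tnth.
    - by move=> y _; rewrite lee_fin prodr_ge0.
  move=> y _; rewrite big_ord_recl tnth0 -EFinM.
  by congr (_ * _)%:E; apply: eq_bigr => i _; rewrite tnthS.
under eq_integral do rewrite inner.
rewrite ge0_integralZl ?lee_fin ?prodr_ge0//=; last 2 first.
- exact/measurable_EFinP.
- by move=> x _; rewrite lee_fin.
by rewrite fc big_ord_recl -EFinM mulrC.
Qed.

(** A null set of [nu1 \x nu2] has [nu2]-null sections for [nu1]-almost every point. These sections
    are [mu2]-null, and the exceptional points are [mu1]-null, so the integral of the sections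
    vanishes. *)
Lemma product_measure1_dominates d1 d2 (T1 : measurableType d1)
    (T2 : measurableType d2) (R : realType) (mu1 nu1 : probability T1 R)
    (mu2 nu2 : probability T2 R) :
  mu1 `<< nu1 -> mu2 `<< nu2 -> (mu1 \x mu2)%E `<< (nu1 \x nu2)%E.
Proof.
move=> dom1 /null_content_dominatesP dom2.
apply/null_content_dominatesP => B mB.
rewrite /= /product_measure1 => nuB0.
have msec (m : probability T2 R) := measurable_fun_xsection m mB.
have /(ae_eq_integral_abs _ measurableT (msec nu2)) ae0 :
    (\int[nu1]_x `|(nu2 \o xsection B) x| = 0)%E.
  by rewrite -[RHS]nuB0; apply: eq_integral => x _; rewrite gee0_abs.
rewrite -[RHS](integral0 mu1 setT); apply: ge0_ae_eq_integral => //.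
  exact: msec.
move: (null_dominates_ae_eq measurableT dom1 ae0) => [N [mN N0 subN]].
exists N; split => // x /= nx; apply: subN => /= sec0; apply: nx => _.
by apply: dom2; [exact: measurable_xsection | exact: sec0].
Qed.

Lemma tuple_product_dominates d (T : measurableType d) (R : realType)
    (n : nat) (mu nu : 'I_n -> probability T R) :
  (forall i, mu i `<< nu i) -> tuple_product mu `<< tuple_product nu.
Proof.
elim: n mu nu => [|n IHn] mu nu munu; first by move=> A.
have /null_content_dominatesP dom := product_measure1_dominates
  (munu ord0) (IHn _ _ (fun i => munu (lift ord0 i))).
apply/null_content_dominatesP => A mA; apply: dom.
by rewrite -[X in measurable X]setTI; exact: measurable_cons_pair.
Qed.

(** * Normal laws on the line *)

(** The Radon-Nikodym derivative and the explicit density have the same integral over every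
    measurable set, hence agree almost everywhere. *)
Lemma integral_normal_prob (R : realType) (m s : R) (f : R -> \bar R) :
  measurable_fun setT f -> (forall x, 0 <= f x)%E ->
  (\int[normal_prob m s]_x f x =
   \int[lebesgue_measure]_x (f x * (normal_pdf m s x)%:E))%E.
Proof.
move=> mf f0; have dom := normal_prob_dominates m s.
rewrite -(Radon_Nikodym_SigmaFinite.change_of_variables dom)//.
have mrn := measurable_int _ (Radon_Nikodym_SigmaFinite.f_integrable dom).
have mpdf : measurable_fun setT (EFin \o normal_pdf m s).
  by apply/measurable_EFinP; exact: measurable_normal_pdf.
apply: ge0_ae_eq_integral => //.
- exact: emeasurable_funM.
- exact: emeasurable_funM.
- by move=> x _; rewrite mule_ge0// Radon_Nikodym_SigmaFinite.f_ge0.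
- by move=> x _; rewrite mule_ge0// lee_fin normal_pdf_ge0.
apply: ae_eqe_mul2l; apply: integral_ae_eq => //.
  exact: Radon_Nikodym_SigmaFinite.f_integrable.
by move=> E _ mE; rewrite -Radon_Nikodym_SigmaFinite.f_integral.
Qed.

Lemma normal_prob_mgf (R : realType) (m a : R) :
  (\int[normal_prob m 1]_x (expR (a * x))%:E =
   (expR (a * m + a ^+ 2 / 2))%:E)%E.
Proof.
rewrite integral_normal_prob; last 2 first.
- by apply/measurable_EFinP; apply: measurableT_comp.
- by move=> x; rewrite lee_fin expR_ge0.
(* Tilting the density by [expR (a * x)] shifts the mean by [a]. *)
have shift x : ((expR (a * x))%:E * (normal_pdf m 1 x)%:E =
    (expR (a * m + a ^+ 2 / 2))%:E * (normal_pdf (m + a) 1 x)%:E)%E.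
  rewrite -!EFinM !normal_pdfE ?oner_neq0// /normal_fun.
  rewrite (mulrCA (expR (a * x))) (mulrCA (expR (a * m + _))) -!expRD.
  congr (_ * expR _)%:E; by field.
under eq_integral do rewrite shift.
rewrite ge0_integralZl//=.
- by rewrite integral_normal_pdf mule1.
- by apply/measurable_EFinP; exact: measurable_normal_pdf.
- by move=> x _; rewrite lee_fin normal_pdf_ge0.
Qed.

(** The normal density is positive everywhere, so a set that is null for one normal law is
    Lebesgue-null, hence null for the other. *)
Lemma normal_prob_dominates_mean (R : realType) (m m' s : R) :
  s != 0 -> normal_prob m s `<< normal_prob m' s.
Proof.
move=> s0; apply: null_dominates_trans (normal_prob_dominates m s) _.
apply/null_content_dominatesP => A mA.
rewrite /normal_prob => A0.
have mpdf : measurable_fun A (EFin \o normal_pdf m' s).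
  by apply/measurable_funTS/measurable_EFinP; exact: measurable_normal_pdf.
have /(ae_eq_integral_abs _ mA mpdf) : (\int[lebesgue_measure]_(x in A)
    `|(EFin \o normal_pdf m' s) x| = 0)%E.
  rewrite -[RHS]A0; apply: eq_integral => x _ /=.
  by rewrite ger0_norm// normal_pdf_ge0.
move=> [N [mN N0 AN]]; apply/eqP; rewrite -measure_le0 -N0.
apply: le_measure; rewrite ?inE// => x Ax; apply: AN => /= /(_ Ax).
move=> /eqP; rewrite eqe gt_eqF// normal_pdfE//.
by rewrite mulr_gt0 ?normal_peak_gt0 ?expR_gt0.
Qed.

(** * Path scores: exponential moments and tail bound *)

Definition path_score (R : realType) (M N : nat) (s : N.-tuple 'I_M)
    (y : data_array R M N) : R :=
  \sum_(n < N) tnth (tnth y n) (tnth s n).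

Lemma measurable_path_score (R : realType) (M N : nat) (s : N.-tuple 'I_M) :
  measurable_fun setT (@path_score R M N s).
Proof.
apply: measurable_sum => n; apply: (@measurableT_comp _ _ _ _ _ _
  (fun col : M.-tuple (measurableTypeR R) => tnth col (tnth s n))).
  exact: measurable_tnth.
exact: measurable_tnth.
Qed.

Lemma gaussian_array_mgf (R : realType) (M N : nat) (mean : 'I_M -> 'I_N -> R)
    (s : N.-tuple 'I_M) (a : R) :
  (\int[gaussian_array mean]_y (expR (a * path_score s y))%:E =
   (expR (\sum_n (a * mean (tnth s n) n + a ^+ 2 / 2)))%:E)%E.
Proof.
rewrite expR_sum.
under eq_integral do rewrite mulr_sumr expR_sum.
apply: (ge0_integral_tuple_product_prod
  (f := fun n (col : M.-tuple (measurableTypeR R)) =>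
          expR (a * tnth col (tnth s n)))).
- move=> n; apply: measurableT_comp => //; apply: measurable_funM => //.
  exact: measurable_tnth.
- by move=> n col; exact: expR_ge0.
move=> n.
(* Padding with factors [1] turns a function of the single entry [tnth s n] into a product over the
   whole column, so that the product formula applies again. *)
have pick (g : 'I_M -> R) :
    g (tnth s n) = \prod_m (if m == tnth s n then g m else 1).
  by rewrite -big_mkcond big_pred1_eq.
under eq_integral => col _.
  rewrite (pick (fun m => expR (a * tnth col m))).
  over.
rewrite (pick (fun m => expR (a * mean m n + a ^+ 2 / 2))).
apply: (ge0_integral_tuple_product_prod
  (f := fun m (x : measurableTypeR R) =>
          if m == tnth s n then expR (a * x) else 1)).
- by move=> m; case: (m == _) => //; do 2! apply: measurableT_comp => //.
- by move=> m x; case: (m == _); rewrite ?expR_ge0.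
move=> m; case: (m == _); first exact: normal_prob_mgf.
by rewrite integral_cst// mul1e [LHS]probability_setT.
Qed.

(** This serves only to show that the miss probability is positive, so that its logarithm is
    meaningful. *)
Lemma null_law_dominates (R : realType) (M N : nat) (beta : R)
    (s : N.-tuple 'I_M) : @null_law R M N `<< path_law beta s.
Proof.
apply: tuple_product_dominates => n; apply: tuple_product_dominates => m.
exact: normal_prob_dominates_mean.
Qed.

Lemma markov_ge0 d (T : measurableType d) (R : realType)
    (Q : probability T R) (f : T -> R) (c : R) :
  measurable_fun setT f -> (forall x, 0 <= f x) -> 0 < c ->
  (Q [set x | (c <= f x)%R] <= c^-1%:E * \int[Q]_x (f x)%:E)%E.
Proof.
move=> mf f0 c0.
rewrite -(@lee_pmul2l _ c%:E) ?lte_fin// muleA -EFinM divff ?gt_eqF// mul1e.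
have := le_integral_abse Q measurableT (g := EFin \o f) _ c0.
rewrite setTI (_ : [set x | _] = [set x | c <= f x]); last first.
  by apply/seteqP; split => x /=; rewrite ger0_norm.
rewrite (eq_integral (fun x => (f x)%:E)).
  by apply; exact/measurable_EFinP.
by move=> x _ /=; rewrite ger0_norm.
Qed.

(** Chernoff bound: under [path_law beta s] the score has mean [N * beta] and variance [N], and the
    slope [- (beta - t)] is the one that optimizes the exponent. *)
Lemma path_law_lower_tail (R : realType) (M N : nat) (beta t : R)
    (s : N.-tuple 'I_M) : t <= beta ->
  (path_law beta s [set y | (path_score s y <= N%:R * t)%R] <=
   (expR (- (N%:R * ((beta - t) ^+ 2 / 2))))%:E)%E.
Proof.
move=> tb.
have sub : [set y | path_score s y <= N%:R * t] `<=`
  [set y | expR (- (beta - t) * (N%:R * t)) <=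
           expR (- (beta - t) * path_score s y)].
  by move=> y /= ys; rewrite ler_expR !mulNr lerN2 ler_wpM2l// subr_ge0.
have mscore := @measurable_path_score R M N s.
have mexp : measurable_fun setT
    (fun y : data_array R M N => expR (- (beta - t) * path_score s y)).
  by do 2! apply: measurableT_comp => //.
have meas_le (f g : data_array R M N -> R) : measurable_fun setT f ->
    measurable_fun setT g -> measurable [set y | f y <= g y].
  by move=> mf mg; rewrite -[X in measurable X]setTI; exact: measurable_fun_le.
apply: (le_trans (le_measure _ _ _ sub)); rewrite ?inE; try exact: meas_le.
apply: (le_trans (markov_ge0 _ mexp _ (expR_gt0 _))).
  by move=> y; exact: expR_ge0.
rewrite gaussian_array_mgf -EFinM -expRN -expRD lee_fin ler_expR.
under eq_bigr do rewrite eqxx.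
rewrite sumr_const card_ord -mulr_natl.
by rewrite le_eqVlt; apply/orP; left; apply/eqP; field.
Qed.

(** * Path probabilities of the chain *)

Lemma big_tupleS (V : nmodType) (I : finType) (n : nat)
    (F : n.+1.-tuple I -> V) :
  \sum_s F s = \sum_i \sum_(s : n.-tuple I) F [tuple of i :: s].
Proof.
rewrite pair_big/=.
rewrite (reindex (fun p : I * n.-tuple I => [tuple of p.1 :: p.2]))//=.
exists (fun s => (thead s, [tuple of behead s])) => [[i s] _|s _].
  by congr pair; apply/val_inj.
by rewrite -tuple_eta.
Qed.

(** The rows of [P] sum to 1, so the later states sum out one by one. The vector [v] is arbitrary in
    order to cover both [pi], of total 1, and [const_mx 1], of total [M]. *)
Lemma sum_path_prob (R : realType) (M N : nat) (P : 'M[R]_M) (v : 'rV[R]_M) :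
  transition_matrix P ->
  \sum_(s : N.+1.-tuple 'I_M) path_prob P v s = \sum_i v 0 i.
Proof.
move=> [_ P1]; rewrite big_tupleS; apply: eq_bigr => i _.
rewrite /path_prob /= -mulr_sumr -[RHS]mulr1; congr (_ * _).
elim: N i => [|N IHN] i.
  rewrite (big_pred1 [tuple]) => [|s]; first by rewrite big_nil.
  by rewrite (tuple0 s); apply/esym/eqP.
rewrite big_tupleS -[RHS](P1 i); apply: eq_bigr => j _ /=.
under eq_bigr do rewrite big_cons.
by rewrite -mulr_sumr IHN mulr1.
Qed.

Lemma path_prob_ge0 (R : realType) (M N : nat) (P : 'M[R]_M) (v : 'rV[R]_M)
    (s : N.-tuple 'I_M) :
  transition_matrix P -> (forall i, 0 <= v 0 i) -> 0 <= path_prob P v s.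
Proof.
move=> [P0 _] v0; rewrite /path_prob; case: (val s) => // i r.
rewrite mulr_ge0//; elim: r i => [|j r IHr] i /=; first by rewrite big_nil.
by rewrite big_cons mulr_ge0.
Qed.

(** A nonzero product has nonzero factors, and each of the [N] transitions between the [N.+1] states
    then contributes [K%:R^-1]. *)
Lemma path_prob_regular (R : realType) (M K N : nat) (P : 'M[R]_M)
    (v : 'rV[R]_M) (s : N.+1.-tuple 'I_M) :
  uniform_walk_on_regular_graph K P -> path_prob P v s != 0 ->
  path_prob P (const_mx 1) s = K%:R^-1 ^+ N.
Proof.
move=> PK; case/tupleP: s => i s.
rewrite /path_prob /= mxE mul1r mulf_eq0 negb_or => /andP[_].
rewrite -[in RHS](size_tuple s); elim: (val s) i => [|j r IHr] i /=.
  by rewrite big_nil.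
rewrite !big_cons mulf_eq0 negb_or exprS => /andP[Pij /IHr ->].
by rewrite (PK i).2.
Qed.

(** * The test statistic and its mean under the null law *)

(* [path_prob P (const_mx 1) s] is [K ^- N] on the paths with [N + 1] states and
   [0] elsewhere, whatever the initial state. *)
Definition path_score_sum (R : realType) (M N : nat) (P : 'M[R]_M) (t : R)
    (y : data_array R M N) : R :=
  \sum_(s : N.-tuple 'I_M)
    path_prob P (const_mx 1) s * expR (t * path_score s y).

Lemma measurable_path_score_sum (R : realType) (M N : nat) (P : 'M[R]_M)
    (t : R) :
  measurable_fun setT (@path_score_sum R M N P t).
Proof.
apply: measurable_sum => s; apply: measurable_funM => //.
do 2! apply: measurableT_comp => //; exact: measurable_path_score.
Qed.

Lemma const1_ge0 (R : realType) (M : nat) (i : 'I_M) :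
  0 <= (const_mx 1 : 'rV[R]_M) 0 i.
Proof. by rewrite mxE. Qed.

(** Under the null law all path scores have the same exponential moment, and the path weights add up
    to [M], so no paths have to be counted. *)
Lemma null_mean_path_score_sum (R : realType) (M N : nat) (P : 'M[R]_M)
    (t : R) :
  transition_matrix P ->
  (\int[@null_law R M N.+1]_y (path_score_sum P t y)%:E =
   (M%:R * expR (N.+1%:R * (t ^+ 2 / 2)))%:E)%E.
Proof.
move=> HP.
under eq_integral do rewrite -sumEFin.
rewrite ge0_integral_sum//; last 2 first.
- move=> s; apply/measurable_EFinP; apply: measurable_funM => //.
  do 2! apply: measurableT_comp => //; exact: measurable_path_score.
- move=> s y _; rewrite lee_fin mulr_ge0 ?expR_ge0// path_prob_ge0//.
  exact: const1_ge0.
rewrite (eq_bigr (fun s => (path_prob P (const_mx 1) s *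
    expR (N.+1%:R * (t ^+ 2 / 2)))%:E)) => [|s _].
  rewrite sumEFin -mulr_suml sum_path_prob//.
  under eq_bigr do rewrite mxE.
  by rewrite sumr_const card_ord.
under eq_integral do rewrite EFinM.
rewrite ge0_integralZl//.
- rewrite gaussian_array_mgf EFinM; congr (_ * (expR _)%:E)%E.
  under eq_bigr do rewrite mulr0 add0r.
  by rewrite sumr_const card_ord mulr_natl.
- apply/measurable_EFinP.
  do 2! apply: measurableT_comp => //; exact: measurable_path_score.
- by rewrite lee_fin path_prob_ge0//; exact: const1_ge0.
Qed.

(** This is the contribution to [path_score_sum] of one admissible path whose score is exactly
    [N.+1%:R * t]. *)
Definition score_threshold (R : realType) (K N : nat) (t : R) : R :=
  K%:R^-1 ^+ N * expR (N.+1%:R * t ^+ 2).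

Definition score_detector (R : realType) (M K N : nat) (P : 'M[R]_M) (t : R) :
    set (data_array R M N.+1) :=
  [set y | score_threshold K N t <= path_score_sum P t y].

Arguments score_detector {R M} K N P t.

(** * Error probabilities of the detector *)

Section score_detector.
Context (R : realType) (M K : nat) (P : 'M[R]_M) (pi : 'rV[R]_M).
Hypotheses (HP : transition_matrix P) (K0 : (0 < K)%N).
Hypothesis PK : uniform_walk_on_regular_graph K P.
Hypothesis Hpi : stationary_distribution P pi.

Lemma measurable_score_detector (N : nat) (t : R) :
  measurable (score_detector K N P t).
Proof.
rewrite -[X in measurable X]setTI; apply: measurable_fun_le => //.
exact: measurable_path_score_sum.
Qed.

(** Markov's inequality; the quotient of mean and threshold is arranged as a geometric sequence in
    [N], whose ratio is below 1 once [t ^+ 2 / 2] exceeds [ln K%:R]. *)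
Lemma false_alarm_score_detector (N : nat) (t : R) :
  (false_alarm_prob (score_detector K N P t) <=
   (M%:R * expR (- (t ^+ 2 / 2)) * expR (- (t ^+ 2 / 2 - ln K%:R)) ^+ N)%:E)%E.
Proof.
have c0 : 0 < score_threshold K N t.
  by rewrite mulr_gt0 ?expR_gt0// exprn_gt0// invr_gt0 ltr0n.
apply: (le_trans (markov_ge0 _ _ _ c0)).
- exact: measurable_path_score_sum.
- move=> y; apply: sumr_ge0 => s _; rewrite mulr_ge0 ?expR_ge0//.
  by rewrite path_prob_ge0//; exact: const1_ge0.
rewrite null_mean_path_score_sum// -EFinM lee_fin.
have lnKE : K%:R = expR (ln K%:R) :> R by rewrite lnK// posrE ltr0n.
rewrite /score_threshold lnKE -expRN -!expRM_natl expRK invfM -!expRN.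
rewrite mulrCA -!mulrA -!expRD le_eqVlt; apply/orP; left; apply/eqP.
by congr (_ * expR _); field.
Qed.

Lemma miss_score_detector (N : nat) (beta t : R) :
  0 < t -> t <= beta ->
  (miss_prob beta P pi (score_detector K N P t) <=
   (expR (- (N.+1%:R * ((beta - t) ^+ 2 / 2))))%:E)%E.
Proof.
case: Hpi => pi0 pi1 _ t0 tb.
rewrite /miss_prob /alternative_law.
set e := expR _.
(* Since the path probabilities sum to 1, the bound can be spread over the paths and compared term
   by term. *)
have -> : e%:E = (\sum_(s : N.+1.-tuple 'I_M) (path_prob P pi s)%:E * e%:E)%E.
  under eq_bigr do rewrite -EFinM.
  by rewrite sumEFin -mulr_suml sum_path_prob// pi1 mul1r.
apply: lee_sum => s _.
have [->|ps0] := eqVneq (path_prob P pi s) 0; first by rewrite !mul0e.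
apply: lee_wpmul2l; first by rewrite lee_fin path_prob_ge0.
apply: le_trans (path_law_lower_tail _ tb).
apply: le_measure; rewrite ?inE.
- by apply: measurableC; exact: measurable_score_detector.
- rewrite -[X in measurable X]setTI; apply: measurable_fun_le => //.
  exact: measurable_path_score.
move=> y /= /negP; rewrite -ltNge => ylt.
(* All terms of the sum are nonnegative, so the true path's term alone stays below the threshold;
   cancelling [K%:R^-1 ^+ N] and using [0 < t] bounds its score. *)
have : K%:R^-1 ^+ N * expR (t * path_score s y) < score_threshold K N t.
  apply: le_lt_trans ylt; rewrite /path_score_sum (bigD1 s)//=.
  rewrite (path_prob_regular PK ps0) lerDl sumr_ge0// => s' _.
  by rewrite mulr_ge0 ?expR_ge0// path_prob_ge0//; exact: const1_ge0.
rewrite ltr_pM2l ?exprn_gt0 ?invr_gt0 ?ltr0n// ltr_expR expr2 mulrCA.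
by rewrite ltr_pM2l// => /ltW.
Qed.

(** Some path has positive probability, and its law dominates the null law, so it charges [A]. *)
Lemma alternative_law_gt0 (N : nat) (beta : R) (A : set (data_array R M N.+1)) :
  measurable A -> (0 < null_law N.+1 A)%E ->
  (0 < alternative_law beta P pi A)%E.
Proof.
case: Hpi => pi0 pi1 _ mA A0.
have path_gt0 s : (0 < path_law beta s A)%E.
  rewrite lt_neqAle measure_ge0 andbT eq_sym; apply/eqP => sA0.
  have /null_content_dominatesP dom := @null_law_dominates R M N.+1 beta s.
  by move: A0; rewrite (dom _ mA sA0) ltxx.
have [s s_neq0] : exists s : N.+1.-tuple 'I_M, path_prob P pi s != 0.
  apply/existsP; rewrite -negb_forall; apply/negP => /forallP all0.
  have := sum_path_prob N pi HP; rewrite pi1 big1 => [/esym/eqP|s _].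
    by rewrite oner_eq0.
  exact/eqP/all0.
have term_ge0 s' : (0 <= (path_prob P pi s')%:E * path_law beta s' A)%E.
  apply: mule_ge0; last exact: ltW (path_gt0 s').
  by rewrite lee_fin path_prob_ge0.
rewrite /alternative_law (bigD1 s)//=; apply: (@lt_le_trans _ _
  ((path_prob P pi s)%:E * path_law beta s A)%E).
  apply: mule_gt0; last exact: path_gt0.
  by rewrite lte_fin lt_neqAle eq_sym s_neq0 path_prob_ge0.
by apply: leeDl; apply: sume_ge0 => s' _; exact: term_ge0.
Qed.

Lemma alternative_law_le1 (N : nat) (beta : R) (A : set (data_array R M N.+1)) :
  measurable A -> (alternative_law beta P pi A <= 1)%E.
Proof.
case: Hpi => pi0 pi1 _ mA.
have -> : 1%E = (\sum_(s : N.+1.-tuple 'I_M) (path_prob P pi s)%:E)%E :> \bar R.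
  by rewrite sumEFin sum_path_prob// pi1.
apply: lee_sum => s _; rewrite -[leRHS]mule1.
by apply: lee_wpmul2l; rewrite ?probability_le1// lee_fin path_prob_ge0.
Qed.

End score_detector.

(** * From error probabilities to the exponent *)

Theorem proposition6 (R : realType) (M K : nat) (beta eps eta : R)
    (P : 'M[R]_M) (pi : 'rV[R]_M)
    (D : forall N : nat, set (data_array R M N)) :
  0 < beta ->
  transition_matrix P ->
  irreducible_chain P ->
  aperiodic_chain P ->
  uniform_walk_on_regular_graph K P ->
  stationary_distribution P pi ->
  0 < eps < 1 ->
  (forall N : nat, optimal_detector beta P pi eps (D N)) ->
  is_error_exponent beta P pi D eta ->
  (if beta <= Num.sqrt (2 * ln K%:R) then 0
   else beta ^+ 2 / 2 - beta * Num.sqrt (2 * ln K%:R) + ln K%:R) <= eta.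
Proof.
move=> beta0 HP _ _ PK Hpi /andP[eps0 eps1] Dopt.
rewrite /is_error_exponent -cvg_shiftS => Deta.
have [pi0 pi1 _] := Hpi.
(* [M = 0] contradicts that [pi] sums to 1, and [K = 0] would make the rows of [P] vanish. *)
have K0 : (0 < K)%N.
  case: M P pi D HP PK Hpi Dopt Deta pi0 pi1 => [|M'] P' pi' D' HP' PK' _ _ _ _.
    by rewrite big_ord0 => /esym/eqP; rewrite oner_eq0.
  move=> _; rewrite lt0n; apply/eqP => K0; have [] := PK' ord0.
  rewrite K0 => /eqP; rewrite cards_eq0 => /eqP P0 _.
  have := HP'.2 ord0; rewrite big1 => [/esym/eqP|j _]; first by rewrite oner_eq0.
  by move/setP/(_ j): P0; rewrite !inE => /negbFE/eqP.
pose miss N := miss_prob beta P pi (D N.+1).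
have mD N : measurable (D N) by have [] := Dopt N.
(* Needed because of the junk value [ln 0 = 0]. *)
have miss_gt0 N : (0 < miss N)%E.
  apply: (alternative_law_gt0 HP Hpi); first exact: measurableC (mD _).
  have [_ fa _] := Dopt N.+1.
  (* The complement of the detector has null probability at least [1 - eps]. *)
  rewrite probability_setC; last exact: mD.
  rewrite sube_gt0.
  by apply: le_lt_trans fa _; rewrite lte_fin.
have miss_le1 N : (miss N <= 1)%E.
  by apply: (alternative_law_le1 HP Hpi); exact: measurableC (mD _).
have miss_fin N : miss N \is a fin_num.
  by rewrite ge0_fin_numE ?ltW// (le_lt_trans (miss_le1 N))// ltry.
(* An exponential bound on the misses need only hold eventually to pass to the limit; for small
   [beta] the trivial bound by 1, with [a = 0], is enough. *)
have exponent_ge (a : R) : (\forall N \near \oo, miss N <=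
    (expR (- (N.+1%:R * a)))%:E)%E -> a <= eta.
  move=> missa; rewrite -(cvg_lim (@Rhausdorff R) Deta).
  apply: limr_ge; first exact: (cvgP eta).
  near=> N; rewrite /= -[X in ln (fine X)]/(miss N).
  have miss_pos : 0 < fine (miss N).
    by rewrite fine_gt0// miss_gt0/= (le_lt_trans (miss_le1 N))// ltry.
  have missN : fine (miss N) <= expR (- (N.+1%:R * a)).
    by rewrite -lee_fin fineK//; near: N.
  rewrite lerNr ler_pdivrMl ?ltr0n// mulrN -[leRHS]expRK.
  by rewrite ler_ln// posrE expR_gt0.
case: ifPn => [_|]; last rewrite -ltNge => rbeta.
  apply: exponent_ge; apply: nearW => N.
  by rewrite mulr0 oppr0 expR0.
set r := Num.sqrt _ in rbeta *.
have r0 : 0 <= r by exact: sqrtr_ge0.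
have lnK_ge0 : 0 <= ln K%:R :> R by rewrite ln_ge0// ler1n.
have r2 : r ^+ 2 = 2 * ln K%:R by rewrite sqr_sqrtr// mulr_ge0.
have detector_bound t : r < t -> t < beta -> (beta - t) ^+ 2 / 2 <= eta.
  move=> rt tbeta; have t0 : 0 < t by exact: le_lt_trans rt.
  apply: exponent_ge.
  set q := expR (- (t ^+ 2 / 2 - ln K%:R)).
  have q1 : `|q| < 1.
    rewrite ger0_norm ?expR_ge0// expR_lt1 oppr_lt0 subr_gt0.
    rewrite ltr_pdivlMr// mulrC -r2.
    by rewrite ltr_pXn2r// nnegrE ltW.
  have := @cvg_geometric _ (M%:R * expR (- (t ^+ 2 / 2))) _ q1.
  (* For large [N] the false alarm bound drops below [eps], so the score detector competes with the
     optimal one. *)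
  move=> /cvgr_le /(_ _ eps0); apply: filterS => N faN.
  have [_ _ opt] := Dopt N.+1.
  apply: le_trans (miss_score_detector HP K0 PK Hpi N t0 (ltW tbeta)).
  apply: opt; first exact: measurable_score_detector.
  apply: le_trans (false_alarm_score_detector HP K0 N t) _.
  by rewrite lee_fin.
(* The claimed bound is a perfect square, the value of [detector_bound] at the excluded endpoint
   [t = r]. *)
have -> : beta ^+ 2 / 2 - beta * r + ln K%:R = (beta - r) ^+ 2 / 2.
  have -> : ln K%:R = r ^+ 2 / 2 by rewrite r2; field.
  by field.
rewrite leNgt; apply/negP => eta_lt.
set b := beta - r in eta_lt *; have b0 : 0 < b by rewrite subr_gt0.
(* The limit [t] to [r] is replaced by a contradiction at [t = r + h]. The first bound on [h] keeps
   [t < beta]; the second makes [b * h] at most half the gap [b ^+ 2 / 2 - eta], so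
   [(b - h) ^+ 2 / 2] still exceeds [eta]. *)
pose h := Num.min (b / 2) ((b ^+ 2 / 2 - eta) / (2 * b)).
have h0 : 0 < h by rewrite lt_min !divr_gt0 ?subr_gt0// mulr_gt0.
have hb : h <= b / 2 by rewrite ge_min lexx.
have heta : b * h <= (b ^+ 2 / 2 - eta) / 2.
  have : h <= (b ^+ 2 / 2 - eta) / (2 * b) by rewrite ge_min lexx orbT.
  by rewrite ler_pdivlMr ?mulr_gt0// ler_pdivlMr// => ?; nra.
have := detector_bound (r + h); rewrite ltrDl h0 => /(_ isT).
have -> : beta - (r + h) = b - h by rewrite /b opprD addrA.
have -> : r + h < beta by rewrite -ltrBrDl -/b; lra.
by move=> /(_ isT); nra.
Unshelve. all: by end_near.
Qed.
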